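(* Let $\mathcal{A}$ be a complete abelian left symmetric algebra of dimension $n\ge 1$ over $\mathbb{R}$ equipped with a nondegenerate Hessian type inner product $H$, and let $F:\mathcal{A}\to\mathbb{R}$ be the associated polynomial $$F(x)=H\Big(x,\big(\tfrac12 I-\tfrac13\lambda_x+\tfrac14\lambda_x^2-\cdots\big)x\Big).$$ Then $\mathcal{A}$ is filiform if and only if $F$ is the Cayley polynomial, i.e. there is a linear coordinate system $(x_1,\dots,x_n)$ on $\mathcal{A}$ in which, up to sign, $$F(x)=\sum_{d=2}^{n+1}(-1)^d\frac1d\sum_{i_1+\cdots+i_d=n+1}x_{i_1}x_{i_2}\cdots x_{i_d},$$ where the inner sum is over ordered $d$-tuples of positive integers with sum $n+1$.
   Context: A left symmetric algebra (LSA) is a finite-dimensional real vector space with a bilinear product such that the associator $(a,b,c)=(ab)c-a(bc)$ satisfies $(a,b,c)=(b,a,c)$. It is abelian if its product is commutative (hence it is commutative and associative). $\lambda_a(b)=ab$, $\rho_a(b)=ba$. It is complete if $\operatorname{tr}\rho_a=0$ for all $a$; for an abelian LSA this means all $\lambda_a$ are nilpotent, so the series defining $F$ is a finite sum. An inner product is a symmetric bilinear form, not necessarily positive definite; on an abelian LSA it is of Hessian type if $H(a,bc)=H(b,ac)$ for all $a,b,c$. For an abelian LSA $\mathcal{A}$ put $\mathcal{A}^1=\mathcal{A}$, $\mathcal{A}^{i+1}=\mathcal{A}\cdot\mathcal{A}^i$ (linear span of products). An $n$-dimensional abelian LSA is filiform if $\dim\mathcal{A}^i=n+1-i$ for $i=1,\dots,n$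 and $\mathcal{A}^{n+1}=\{0\}$ (equivalently $\mathcal{A}^{n+1}=\{0\}$ and $\mathcal{A}^n\ne\{0\}$). *)

(* Defs.v *)
From HB Require Import structures.
From mathcomp Require Import all_boot all_order all_algebra.
From mathcomp Require Import boolp classical_sets filter reals topology normedtype sequences.

Set Implicit Arguments.
Unset Strict Implicit.
Unset Printing Implicit Defensive.

Import Order.TTheory GRing.Theory Num.Theory numFieldNormedType.Exports.

Local Open Scope ring_scope.

Section LeftSymmetricAlgebra.
Variables (K : fieldType) (A : vectType K) (mul : {bilinear A -> A -> A}).

Definition associator (a b c : A) : A := mul (mul a b) c - mul a (mul b c).

Definition left_symmetric : Prop :=
  forall a b c : A, associator a b c = associator b a c.

Definition abelian_lsa : Prop := left_symmetric /\ commutative mul.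

Definition lambda (a : A) : 'End(A) := linfun (mul a).

Definition rho (a : A) : 'End(A) := linfun (applyr mul a).

Lemma lambdaE a b : lambda a b = mul a b.
Proof. by rewrite lfunE. Qed.

Lemma rhoE a b : rho a b = mul b a.
Proof. by rewrite lfunE. Qed.

(* The basis is irrelevant: the trace is invariant under conjugation. *)
Definition lfun_trace (f : 'End(A)) : K :=
  \tr (passmx.mxof (vbasis {:A}) (vbasis {:A}) f).

Definition complete_lsa : Prop := forall a : A, lfun_trace (rho a) = 0.

(* As for [prodv] of falgebra.v, which requires a unital associative algebra:
   by bilinearity, products of basis vectors span all products [mul u v]. *)
Definition lsa_prodv (U V : {vspace A}) : {vspace A} :=
  <<[seq mul u v | u <- vbasis U, v <- vbasis V]>>%VS.

Lemma lsa_prodvP (U V W : {vspace A}) :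
  reflect (forall u v, u \in U -> v \in V -> mul u v \in W)
          (lsa_prodv U V <= W)%VS.
Proof.
apply: (iffP idP) => [sUVW u v Uu Vv | sUVW]; last first.
  apply/span_subvP => _ /allpairsP[[u v] /= [Uu Vv ->]].
  by apply: sUVW; apply: vbasis_mem.
apply: (subvP sUVW); rewrite (coord_vbasis Uu) (coord_vbasis Vv).
rewrite linear_sumlz rpred_sum // => i _; rewrite linear_sumr rpred_sum // => j _.
rewrite linearZl_LR linearZr_LR /= !memvZ //; apply: memv_span.
by apply/allpairsP; exists ((vbasis U)`_i, (vbasis V)`_j); rewrite !memt_nth.
Qed.

(* The powers are indexed from 1: [lsa_pow 1 = A] and
   [lsa_pow i.+1 = A . lsa_pow i] for [1 <= i]; the value at 0 is junk. *)
Definition lsa_pow (i : nat) : {vspace A} :=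
  iter i.-1 (lsa_prodv fullv) fullv.

Definition filiform : Prop :=
  (forall i, (1 <= i <= \dim {:A})%N ->
     \dim (lsa_pow i) = ((\dim {:A}).+1 - i)%N)
  /\ lsa_pow (\dim {:A}).+1 = 0%VS.

Definition hessian_type (H : A -> A -> K) : Prop :=
  forall a b c : A, H a (mul b c) = H b (mul a c).

End LeftSymmetricAlgebra.

Section AssociatedPolynomial.
Local Open Scope classical_set_scope.

(* The series is taken literally, as the limit of its partial sums. When all
   [lambda mul x] are nilpotent, the partial sums are eventually constant. *)
Definition associated_poly (R : realType) (A : vectType R)
    (mul : {bilinear A -> A -> A}) (H : {symmetric A}) (x : A) : R :=
  limn (fun N : nat =>
    H x (\sum_(0 <= k < N) ((-1) ^+ k / k.+2%:R) *: iter k (lambda mul x) x)).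

End AssociatedPolynomial.

(* The variable [x_i], with [1 <= i <= n], is [x j] for [j : 'I_n] with
   [i = j.+1]. Bounding the indices by [n] loses nothing, as [d >= 2] positive
   integers with sum [n.+1] are at most [n]. *)
Definition cayley_poly (K : fieldType) (n : nat) (x : 'I_n -> K) : K :=
  \sum_(2 <= d < n.+2) (-1) ^+ d * d%:R^-1 *
    \sum_(i : {ffun 'I_d -> 'I_n} | (\sum_(k < d) (i k).+1)%N == n.+1)
      \prod_(k < d) x (i k).

Definition is_cayley (K : fieldType) (A : vectType K) (F : A -> K) : Prop :=
  exists e : (\dim {:A}).-tuple A, basis_of {:A} e /\
  exists s : bool,
    forall x : A, F x = (-1) ^+ s * cayley_poly (fun i => coord e i x).

(* Main.v *)
(* In a filiform algebra pick a outside A^2. Modulo A^(i+2) the power A^(i+1) is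
   the line through a^(i+1), so a^n spans A^n, and nondegeneracy forces
   H(a, a^n) <> 0. By the Hessian condition H(a^i, a^j) depends on i + j only;
   a triangular system for the coefficients of a new generator b = q(a) a
   makes H(b^i, b^j) equal to +-1 if i + j = n + 1 and 0 otherwise. The powers
   of b are then a basis, in which F is the Cayley polynomial: its degree d
   part is the coefficient of X^(n+1) in p^d, for p = sum x_i X^i.

   Conversely, completeness makes every element nilpotent, so F is a polynomial
   along every line. Its quadratic and cubic parts give H(x, x) and H(x, x x),
   hence by polarization H(x, y) and H(x, y z), hence the product. *)

From HB Require Import structures.
Require Import Defs.
From mathcomp Require Import all_boot all_order all_algebra reals.
From mathcomp Require Import normedtype exp.
From mathcomp Require Import ring lra zify.

Set Implicit Arguments.
Unset Strict Implicit.
Unset Printing Implicit Defensive.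

Import Order.TTheory GRing.Theory Num.Theory.

Local Open Scope ring_scope.

(** * Nilpotency of a matrix from traces of its powers *)

(** In the rank factorization E = C R, idempotence and cancellation of the full-rank factors give R
    C = 1, and tr (C R) = tr (R C). *)
Lemma mxtrace_idem (F : fieldType) n (E : 'M[F]_n) :
  E *m E = E -> \tr E = (\rank E)%:R.
Proof.
move=> EE; suff RC : row_base E *m col_base E = 1%:M.
  by rewrite -{1}(mulmx_base E) mxtrace_mulC RC mxtrace1.
have /row_fullP[B BC] := col_base_full E.
apply: (row_free_inj (row_base_free E)); rewrite /= mul1mx -mulmxA mulmx_base.
rewrite -[LHS]mul1mx -[RHS]mul1mx -BC -[LHS]mulmxA -[RHS]mulmxA; congr (B *m _).
by rewrite (mulmxA (col_base E)) mulmx_base.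
Qed.

(* If M were not nilpotent, the projector on its invertible Fitting component
   would be a nonzero polynomial in M without constant term, of trace its rank. *)
Lemma mxtrace_nilpotent (F : numFieldType) n (M : 'M[F]_n.+1) :
  (forall k, \tr (M ^+ k.+1) = 0) -> M ^+ n.+1 = 0.
Proof.
move=> trM.
have trX r : \tr (horner_mx M (r * 'X)) = 0.
  rewrite -[r]coefK poly_def mulr_suml rmorph_sum linear_sum big1 //= => i _.
  by rewrite -scalerAl linearZ linearZ /= -exprSr rmorphXn /= horner_mx_X trM mulr0.
have [k [g + pE]] := multiplicity_XsubC (char_poly M) 0.
have p0 := monic_neq0 (char_poly_monic M).
rewrite p0 /= subr0 in pE * => g0.
have gn0 : g != 0 by apply: contraNneq g0 => ->; rewrite root0.
have kn : (k <= n.+1)%N.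
  have := size_char_poly M; rewrite pE size_mul ?expf_neq0 ?polyX_eq0 //.
  by move: gn0; rewrite -size_poly_gt0 size_polyXn; case: (size g) => //; lia.
have MX : horner_mx M ('X ^+ k * g) = 0 by rewrite mulrC -pE Cayley_Hamilton.
have cXg : coprimep ('X ^+ k.+1) g by rewrite coprimep_expl // coprimep_sym coprimepX.
have [[u v] /= uv] := Bezout_eq1_coprimepP _ _ cXg.
(* The exponent k + 1, rather than k, leaves a factor X even when k = 0, so that [trX] applies. *)
pose E := horner_mx M (u * 'X ^+ k.+1).
have EE : E *m E = E.
  have -> : E *m E = E * E by [].
  rewrite /E -rmorphM /= -[in RHS](mulr1 (u * _)) -uv mulrDr rmorphD /=.
  rewrite [X in _ = _ + X](_ : _ = 0) ?addr0 //.
  have -> : u * 'X ^+ k.+1 * (v * g) = (u * 'X * v) * ('X ^+ k * g).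
    by rewrite exprS; ring.
  by rewrite rmorphM /= MX mulr0.
have E0 : E = 0.
  have := mxtrace_idem EE; rewrite {1}/E exprSr mulrA trX => /esym/eqP.
  by rewrite pnatr_eq0 mxrank_eq0 => /eqP.
suff Mk : M ^+ k = 0 by have := exprD M (n.+1 - k) k; rewrite subnK // Mk mulr0.
have : horner_mx M ('X ^+ k * (u * 'X ^+ k.+1 + v * g)) = M ^+ k.
  by rewrite uv mulr1 rmorphXn /= horner_mx_X.
by rewrite mulrDr rmorphD rmorphM /= -/E E0 mulr0 add0r mulrCA rmorphM /= MX mulr0.
Qed.

(** * Powers of an element and polynomials in it *)

Section AbelianLSA.
Variables (K : fieldType) (A : vectType K) (mul : {bilinear A -> A -> A}).
Hypothesis abA : abelian_lsa mul.

Lemma abelian_mulC : commutative mul. Proof. by case: abA. Qed.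

Lemma abelian_mulA : associative mul.
Proof.
case: abA => ls mulC a b c; have := ls a c b; rewrite /associator => /eqP.
rewrite (mulC c a) (inj_eq (addrI _)) eqr_opp => /eqP.
by rewrite (mulC c b) => ->; rewrite mulC.
Qed.

(* [powS a i] is the power a^(i+1): the algebra has no unit. *)
Definition powS (a : A) i := iter i (mul a) a.

Lemma powSS a i : powS a i.+1 = mul a (powS a i). Proof. by []. Qed.

Lemma powS_mul a i j : mul (powS a i) (powS a j) = powS a (i + j).+1.
Proof. by elim: i => //= i IH; rewrite -abelian_mulA IH. Qed.

Lemma powS_eq0 a i j : powS a i = 0 -> (i <= j)%N -> powS a j = 0.
Proof.
by move=> ai0 /subnK <-; elim: (j - i)%N => //= k IH; rewrite IH linear0r.
Qed.

Lemma iter_lambda a k : iter k (lambda mul a) a = powS a k.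
Proof. by elim: k => //= k ->; rewrite lambdaE. Qed.

(* The value at [a] of the polynomial without constant term ['X * p]. *)
Definition evX (a : A) (p : {poly K}) : A := \sum_(i < size p) p`_i *: powS a i.

Lemma evX_wide a (p : {poly K}) m : (size p <= m)%N ->
  evX a p = \sum_(i < m) p`_i *: powS a i.
Proof.
move=> pm; rewrite /evX (big_ord_widen m (fun i => p`_i *: powS a i)) // big_mkcond.
by apply: eq_bigr => i _; case: ltnP => // /(nth_default 0) ->; rewrite scale0r.
Qed.

Lemma evX_is_linear a : linear (evX a).
Proof.
move=> c p q; pose m := maxn (size p) (size q).
have pm : (size p <= m)%N by rewrite leq_maxl.
have qm : (size q <= m)%N by rewrite leq_maxr.
rewrite (evX_wide _ pm) (evX_wide _ qm) (@evX_wide _ _ m); last first.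
  by rewrite (leq_trans (size_polyD _ _)) // geq_max qm (leq_trans (size_scale_leq _ _)).
rewrite scaler_sumr -big_split; apply: eq_bigr => i _ /=.
by rewrite coefD coefZ scalerDl scalerA.
Qed.

HB.instance Definition _ a := GRing.isSemilinear.Build K {poly K} A _ (evX a)
  (GRing.semilinear_linear (evX_is_linear a)).

Lemma evXn a i : evX a 'X^i = powS a i.
Proof.
rewrite (@evX_wide _ _ i.+1) ?size_polyXn // big_ord_recr /= coefXn eqxx scale1r.
by rewrite big1 ?add0r // => j _; rewrite coefXn ltn_eqF ?scale0r.
Qed.

Lemma evX_sum a n (c : 'I_n -> K) :
  evX a (\sum_(i < n) c i *: 'X^i) = \sum_(i < n) c i *: powS a i.
Proof.
by rewrite linear_sum; apply: eq_bigr => i _; rewrite linearZ /= evXn.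
Qed.

(** [evX a p] is the value of X p, and (X p)(X q) = X (X p q): one factor X remains explicit. *)
Lemma evXM a p q : mul (evX a p) (evX a q) = evX a ('X * p * q).
Proof.
rewrite -{2}[p]coefK -{2}[q]coefK !poly_def [in LHS]/evX.
rewrite linear_sumlz -mulrA !mulr_suml mulr_sumr linear_sum; apply: eq_bigr => i _.
rewrite linear_sumr !mulr_sumr linear_sum; apply: eq_bigr => j _ /=.
rewrite linearZl_LR linearZr_LR /= powS_mul -scalerAl -!scalerAr !linearZ /=.
by rewrite -exprD -exprS evXn scalerA mulrC -scalerA.
Qed.

Lemma powS_evX a p k : powS (evX a p) k = evX a ('X^k * p ^+ k.+1).
Proof.
elim: k => [|k IH]; first by rewrite expr0 mul1r expr1.
by rewrite powSS IH evXM (exprS 'X k) (exprS p k.+1); congr evX; ring.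
Qed.

Lemma evX_eq0 a n r : powS a n = 0 -> evX a ('X^n * r) = 0.
Proof.
move=> an0; rewrite -[r]coefK poly_def mulr_sumr linear_sum big1 //= => i _.
by rewrite -scalerAr linearZ /= -exprD evXn (powS_eq0 an0) ?leq_addr ?scaler0.
Qed.

End AbelianLSA.

(** * Nilpotency from completeness *)

Section Complete.
Variables (K : numFieldType) (A : vectType K) (mul : {bilinear A -> A -> A}).
Hypothesis abA : abelian_lsa mul.

(** By associativity the powers of [lambda mul x] are multiplications by powers of x; by
    commutativity these are values of [rho], of trace 0. Hence x^n acts as 0, and applying it to x
    gives x^(n+1) = 0. *)
Lemma complete_powS x : (0 < \dim {:A})%N -> complete_lsa mul ->
  powS mul x (\dim {:A}) = 0.
Proof.
move=> n_gt0 trA; set n := \dim _ in n_gt0 *.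
pose e := vbasis {:A}; have eP : basis_of {:A} e := vbasisP _.
pose mx (y : A) : 'M_n := passmx.mxof e e (lambda mul y).
have mxX k : mx x ^+ k.+1 = mx (powS mul x k).
  elim: k => [|k IH]; first by rewrite expr1.
  rewrite exprSr IH /mx powSS.
  transitivity (passmx.mxof e e (lambda mul x \o lambda mul (powS mul x k))%VF).
    by rewrite (passmx.mxof_comp _ _ eP).
  congr passmx.mxof; apply/lfunP => y.
  by rewrite comp_lfunE !lambdaE (abelian_mulA abA).
have tr0 k : \tr (mx x ^+ k.+1) = 0.
  rewrite mxX -[RHS](trA (powS mul x k)); congr (\tr (passmx.mxof _ _ _)).
  by apply/lfunP => y; rewrite lambdaE rhoE (abelian_mulC abA).
have {tr0} mx0 : mx x ^+ n = 0.
  by move: (n) n_gt0 (mx x) tr0 => [//|m] _ M; apply: mxtrace_nilpotent.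
have := mxX n.-1; rewrite prednK // mx0 => /esym/eqP.
rewrite passmx.mxof_eq0 // => /eqP/lfunP/(_ x).
by rewrite lambdaE lfunE /= (abelian_mulC abA) -powSS prednK.
Qed.
End Complete.

(** * Filiform algebras and generators modulo A^2 *)

Section Filiform.
Variables (K : fieldType) (A : vectType K) (mul : {bilinear A -> A -> A}).
Hypothesis abA : abelian_lsa mul.
Local Notation pow := (lsa_pow mul).

Lemma lsa_powSS i : pow i.+2 = lsa_prodv mul fullv (pow i.+1).
Proof. by []. Qed.

Lemma memv_lsa_prod u v i : v \in pow i.+1 -> mul u v \in pow i.+2.
Proof.
move=> vi; rewrite lsa_powSS.
have /lsa_prodvP := subvv (lsa_prodv mul fullv (pow i.+1)).
by apply => //; rewrite memvf.
Qed.

(** On products, (x y) v = x (y v) climbs two steps; the preimage extends this to their span. *)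
Lemma lsa_pow2_mul i u v : u \in pow 2 -> v \in pow i.+1 -> mul u v \in pow i.+3.
Proof.
move=> u2 vi.
have /subvP/(_ _ u2) : (pow 2 <= linfun (applyr mul v) @^-1: pow i.+3)%VS.
  apply/lsa_prodvP => x y _ _; rewrite -memv_preim lfunE /= -(abelian_mulA abA).
  by do 2 apply: memv_lsa_prod.
by rewrite -memv_preim lfunE.
Qed.

Lemma memv_powS a i : powS mul a i \in pow i.+1.
Proof. by elim: i => [|i IH]; rewrite ?memvf // powSS memv_lsa_prod. Qed.

(* Modulo A^(i+2), a product of [i.+1] elements of A only depends on their
   components along the generator [a]. *)
Lemma lsa_pow_line a : (fullv <= <[a]> + pow 2)%VS ->
  forall i, (pow i.+1 <= <[powS mul a i]> + pow i.+2)%VS.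
Proof.
move=> genA; elim=> [//|i IH].
apply/lsa_prodvP => x v _ vi.
have /memv_addP[_ /vlineP[c ->] [y y2 ->]] := subvP genA _ (memvf x).
have /memv_addP[_ /vlineP[d ->] [w w2 wE]] := subvP IH _ vi.
rewrite linearDl /= memvD //; last by apply: (subvP (addvSr _ _)); apply: lsa_pow2_mul.
rewrite wE linearDr /= memvD //.
  apply: (subvP (addvSl _ _)).
  by rewrite linearZl_LR linearZr_LR /= !memvZ // -powSS memv_line.
by apply: (subvP (addvSr _ _)); rewrite linearZl_LR memvZ ?memv_lsa_prod.
Qed.

Lemma filiform_gen : (0 < \dim {:A})%N -> filiform mul ->
  exists a, (fullv <= <[a]> + pow 2)%VS.
Proof.
move=> n_gt0 [dimA nilA].
have dim2 : \dim (pow 2) = (\dim {:A}).-1.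
  (* For n = 1 the dimension formula stops before A^2, which is then A^(n+1) = 0. *)
  have [n_gt1|n_le1] := ltnP 1 (\dim {:A}); first by rewrite dimA //; lia.
  have n1 : \dim {:A} = 1%N by lia.
  by move: nilA; rewrite n1 => ->; rewrite dimv0.
have : ~~ (fullv <= pow 2)%VS by apply/negP => /dimvS; rewrite dim2; lia.
case/subvPn => a _ a2; exists a.
have : (\dim (pow 2) < \dim (<[a]> + pow 2))%N.
  rewrite (ltn_leqif (dimv_leqif_sup (addvSr _ _))).
  by apply: contra a2 => /subvP; apply; apply: (subvP (addvSl _ _)); apply: memv_line.
rewrite dim2 => lt_dim.
have /eqP -> // : (<[a]> + pow 2)%VS == fullv.
by rewrite eqEdim subvf; lia.
Qed.

(** Each step from A^j to A^(j+1) loses at most one dimension, and n steps lead from dimension n to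
    0, so each loses exactly one. *)
Lemma gen_filiform a : (fullv <= <[a]> + pow 2)%VS -> pow (\dim {:A}).+1 = 0%VS ->
  filiform mul.
Proof.
move=> genA nilA; split=> // i /andP[i_gt0 i_le].
have drop j : (\dim (pow j.+1) <= (\dim (pow j.+2)).+1)%N.
  apply: leq_trans (dimvS (lsa_pow_line genA j)) _.
  apply: leq_trans (dimv_add_leqif _ _).1 _.
  by rewrite dim_vline; case: (_ != 0); lia.
have lower j : (\dim {:A} <= j + \dim (pow j.+1))%N.
  by elim: j => // j IH; have := drop j; lia.
have upper j : (j <= \dim {:A})%N -> (\dim (pow (\dim {:A} - j).+1) <= j)%N.
  elim: j => [_|j IH lt_j]; first by rewrite subn0 nilA dimv0.
  have := drop (\dim {:A} - j.+1)%N; have := IH (ltnW lt_j).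
  by rewrite subnSK //; lia.
have := lower i.-1; have := upper (\dim {:A} - i.-1)%N.
by rewrite subKn ?prednK //; lia.
Qed.

End Filiform.

(** * Polarization, normalization and the Cayley polynomial *)

Lemma exprD_quad (R : comPzRingType) (p u : R) m :
  exists r, (p + u) ^+ m.+1 = p ^+ m.+1 + m.+1%:R * u * p ^+ m + u ^+ 2 * r.
Proof.
elim: m => [|m [r IH]]; first by exists 0; ring.
exists (m.+1%:R * p ^+ m + r * (p + u)).
by rewrite exprS IH (exprS p m.+1) (exprS p m) -(natr1 m.+1); ring.
Qed.

(** The cube of x + y leaves 3 (T x x y + T x y y) = 0; the cube of x + y + z then leaves 6 T x y z
    = 0. *)
Lemma trilinear_polarization (K : realDomainType) (V : zmodType)
    (T : V -> V -> V -> K) :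
  (forall x x' y z, T (x + x') y z = T x y z + T x' y z) ->
  (forall x y z, T x y z = T y x z) -> (forall x y z, T x y z = T x z y) ->
  (forall x, T x x x = 0) -> forall x y z, T x y z = 0.
Proof.
move=> T1 C12 C23 T0.
have T2 x y y' z : T x (y + y') z = T x y z + T x y' z by rewrite C12 T1 !(C12 x).
have T3 x y z z' : T x y (z + z') = T x y z + T x y z'
  by rewrite C23 T2 !(C23 x _ y).
have T2xy x y : T x x y + T x y y = 0.
  have := T0 (x + y); rewrite !(T1, T2, T3) !T0.
  by rewrite (C12 y x x) (C12 y x y) (C23 y y x) (C23 x y x) (C12 y x y); lra.
move=> x y z.
have := T0 (x + y + z); rewrite !(T1, T2, T3) !T0.
have := T2xy x y; have := T2xy y z; have := T2xy x z.
have E u v : (T v u u = T u u v) * (T u v u = T u u v)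
  by rewrite (C12 v u u) (C23 u v u).
rewrite -!(E x y) -!(E x z) -!(E y z) !E.
rewrite (C23 x z y) (C12 y x z) (C23 y z x) (C12 y x z) (C23 z y x)
  (C12 z x y) (C23 x z y).
by move=> *; lra.
Qed.

(** The triangular system for the new generator b, the value of X q at a. With l r = H(a, (X r)(a)),
    the Hessian condition makes [l ('X^k * q ^+ k.+2)] equal to H(b, b^(k+1)). *)
Lemma poly_normalize (K : numFieldType) (l : {scalar {poly K}}) n (c : K) :
  (forall r, l ('X^(n.+1) * r) = 0) -> l 'X^n != 0 -> c != 0 ->
  exists2 q : {poly K}, forall k, (k < n)%N -> l ('X^k * q ^+ k.+2) = 0
    & l ('X^n * q ^+ n.+2) = c ^+ n.+2 * l 'X^n.
Proof.
move=> l0 ln c0.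
have lX m r : (n < m)%N -> l ('X^m * r) = 0.
  by move=> /subnK <-; rewrite addnC exprD -mulrA l0.
have lXn q m : l ('X^n * q ^+ m) = q`_0 ^+ m * l 'X^n.
  have -> : q`_0 ^+ m = (q ^+ m)`_0 by rewrite -!horner_coef0 hornerE.
  move: (q ^+ m) => r.
  have {1}-> : r = (r`_0)%:P + 'X * (drop_poly 1 r).
    rewrite -{1}(poly_take_drop 1 r) expr1 mulrC; congr (_ + _).
    by apply/polyP => -[|i]; rewrite coef_take_poly coefC.
  by rewrite mulrDr mulrA -exprSr linearD /= l0 addr0 mulrC mul_polyC linearZ.
(* Induction on the number j of equations already solved, from k = n - 1 downwards. *)
suff main j : exists2 q : {poly K}, q`_0 = c &
    forall k, (k < n)%N -> (n <= k + j)%N -> l ('X^k * q ^+ k.+2) = 0.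
  have [q q0 qP] := main n; exists q => [k kn|]; last by rewrite lXn q0.
  by apply: qP => //; rewrite leq_addl.
elim: j => [|j [q q0 qP]].
  by exists c%:P => [|k]; rewrite ?coefC //; lia.
have [jn|nj] := ltnP j n; last first.
  by exists q => // k kn _; apply: qP => //; lia.
(* Adding a multiple of X^(j+1) to q alters [l ('X^k * q ^+ k.+2)] only for
   k <= n - (j + 1), and for equality linearly in the added coefficient. *)
pose m := (n - j.+1)%N.
pose d := - l ('X^m * q ^+ m.+2) / (m.+2%:R * c ^+ m.+1 * l 'X^n).
exists (q + d *: 'X^(j.+1)) => [|k kn nk].
  by rewrite coefD coefZ coefXn mulr0 addr0.
have [r ->] := exprD_quad q (d *: 'X^(j.+1)) k.+1.
(* The quadratic remainder carries X^(k + 2(j+1)), which [l] kills since k + j + 1 >= n. *)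
rewrite !mulrDr !linearD /= [X in _ + X = _](_ : _ = 0) ?addr0; last first.
  rewrite exprZn -scalerAl -scalerAr linearZ /= mulrA -exprM -exprD lX ?mulr0 //; lia.
have -> : 'X^k * (k.+2%:R * (d *: 'X^(j.+1)) * q ^+ k.+1) =
    (k.+2%:R * d) *: ('X^(k + j.+1) * q ^+ k.+1).
  by rewrite exprD -!mul_polyC (polyCM k.+2%:R) polyC_natr; ring.
rewrite linearZ /=; have [nE|kE] := eqVneq n (k + j.+1)%N; last first.
  by rewrite (lX (k + j.+1)%N) ?mulr0 ?addr0 ?qP //; lia.
have km : k = m by rewrite /m; lia.
rewrite -nE lXn q0 km /d; field.
by rewrite ln expf_neq0 //= -natrD pnatr_eq0.
Qed.

(** For q = sum x_i X^i with indices from 0, the inner sum for d = k + 2 is the coefficient of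
    X^(n+1) in (X q)^d; a factor X^2 is divided out. *)
Lemma cayley_polyE (K : fieldType) n (x : 'I_n -> K) :
  cayley_poly x = \sum_(k < n) (-1) ^+ k * k.+2%:R^-1 *
    ('X^k * (\sum_(i < n) x i *: 'X^i) ^+ k.+2)`_n.-1.
Proof.
rewrite /cayley_poly -[2%N]add0n big_addn subn2 /= big_mkord.
apply: eq_bigr => k _; rewrite addn2.
have -> : (-1) ^+ k.+2 = (-1) ^+ k :> K by rewrite !exprS; ring.
have kn : (k <= n.-1)%N by have := ltn_ord k; lia.
congr (_ * _); rewrite coefXnM ltnNge kn /=.
rewrite -[k.+2 in RHS]card_ord -prodr_const bigA_distr_bigA coef_sum.
rewrite big_mkcond /=; apply: eq_bigr => f _.
rewrite (_ : \prod_i _ = (\prod_i x (f i)) *: 'X^(\sum_i f i)); last first.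
  by rewrite scaler_prod prodrXr.
rewrite coefZ coefXn; under eq_bigr do rewrite -addn1.
rewrite big_split /= sum1_card card_ord.
rewrite (_ : (_ == n.+1) = (n.-1 - k == \sum_(i < k.+2) f i)%N); last first.
  by move: kn (ltn_ord k) (\sum_(i < k.+2) f i)%N => /=; lia.
by case: ifP => _; rewrite /= ?mulr1 ?mulr0.
Qed.

Lemma poly_roots_eq0 (K : numDomainType) (p : {poly K}) :
  (forall t, t != 0 -> p.[t] = 0) -> p = 0.
Proof.
move=> p0; apply/eqP; apply: contraT => pn0.
have := max_poly_roots (rs := [seq i.+1%:R | i <- iota 0 (size p)]) pn0.
rewrite size_map size_iota ltnn; apply.
  by apply/allP => _ /mapP[i _ ->]; apply/rootP; rewrite p0 // pnatr_eq0.
by rewrite map_inj_uniq ?iota_uniq // => i j /eqP; rewrite eqr_nat => /eqP[].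
Qed.

(** * The series as a finite sum, and the Hessian pairing of powers *)

Section Series.
Import numFieldNormedType.Exports.

Lemma associated_polyE (R : realType) (A : vectType R)
    (mul : {bilinear A -> A -> A}) (H : {symmetric A}) x n : powS mul x n = 0 ->
  associated_poly mul H x =
    \sum_(k < n) (-1) ^+ k / k.+2%:R * H x (powS mul x k).
Proof.
move=> xn0; rewrite /associated_poly; apply: norm_lim_near_cst.
exists n => // N /= nN.
rewrite big_mkord linear_sumr /=.
rewrite (big_ord_widen _ (fun k => (-1) ^+ k / k.+2%:R * H x (powS mul x k)) nN).
rewrite [RHS]big_mkcond /=; apply: eq_bigr => k _.
rewrite linearZr_LR /= iter_lambda; case: ltnP => // nk.
by rewrite (powS_eq0 xn0 nk) linear0r mulr0.
Qed.

End Series.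

Section Hessian.
Variables (R : realType) (A : vectType R) (mul : {bilinear A -> A -> A}).
Variable H : {symmetric A}.
Hypothesis abA : abelian_lsa mul.
Hypothesis hessH : hessian_type mul H.

Lemma symC u v : H u v = H v u.
Proof. by rewrite hermC expr0 mul1r. Qed.

Lemma hessian_mul a b c : H (mul a b) c = H a (mul b c).
Proof. by rewrite symC hessH (abelian_mulC abA). Qed.

(** Moving factors across [H] gives H(a^(i+1), a^(j+1)) = H(a, a^(i+j+1)), so the pairing depends
    only on the product p q. *)
Lemma hessian_evX a p q : H (evX mul a p) (evX mul a q) = H a (evX mul a (p * q)).
Proof.
rewrite -{2}[p]coefK -{2}[q]coefK !poly_def [in LHS]/evX.
rewrite linear_sumlz !mulr_suml (linear_sum (evX mul a)) linear_sumr.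
apply: eq_bigr => i _.
rewrite linear_sumr !mulr_sumr (linear_sum (evX mul a)) linear_sumr.
apply: eq_bigr => j _ /=.
have -> : p`_i *: 'X^i * (q`_j *: 'X^j) = (p`_i * q`_j) *: 'X^(i + j) :> {poly R}.
  by rewrite exprD -!mul_polyC polyCM; ring.
rewrite [evX mul a (_ *: _)]linearZ /= evXn linearZl_LR !linearZr_LR /= mulrA.
congr (_ * _); case: (nat_of_ord i) => [|k] //.
by rewrite powSS hessian_mul powS_mul.
Qed.

End Hessian.

Lemma exists_root_inv (R : realType) (g : R) n : 0 < g ->
  exists2 c : R, c != 0 & c ^+ n.+1 * g = 1.
Proof.
move=> g0; exists (g^-1 `^ n.+1%:R^-1); first by rewrite gt_eqF // powR_gt0 // invr_gt0.
rewrite -powR_mulrn ?powR_ge0 // -powRrM mulVf ?pnatr_eq0 // powRr1 ?mulVf ?gt_eqF //.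
by rewrite invr_ge0 ltW.
Qed.

(** * From filiform to Cayley *)

Section Forward.
Variables (R : realType) (A : vectType R) (mul : {bilinear A -> A -> A}).
Variable H : {symmetric A}.
Hypothesis n_gt0 : (0 < \dim {:A})%N.
Hypothesis abA : abelian_lsa mul.
Hypothesis ndH : nondegenerate H.
Hypothesis hessH : hessian_type mul H.
Local Notation n := (\dim {:A}).

(** The vector v = a^n spans the line A^n and is annihilated by A, so H(x z, v) = H(x, z v) = 0 and
    v is orthogonal to A^2. Were it also orthogonal to a, it would lie in the radical of [H]. *)
Lemma filiform_pairing_neq0 a : filiform mul ->
  (fullv <= <[a]> + lsa_pow mul 2)%VS -> H a (powS mul a n.-1) != 0.
Proof.
move=> [dimA nilA] genA; set v := powS mul a n.-1.
have mulv u : mul u v = 0.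
  apply/eqP; rewrite -memv0 -nilA -(prednK n_gt0) memv_lsa_prod //.
  exact: memv_powS.
have v_neq0 : v != 0.
  have := dimvS (lsa_pow_line abA genA n.-1); rewrite prednK // nilA addv0.
  by rewrite dimA ?leqnn ?andbT // dim_vline; case: (v == 0) => //=; lia.
apply: contraNneq v_neq0 => Hav.
rewrite -memv0 -(eqP ndH); apply/mem_orthovP => u _.
have /memv_addP[_ /vlineP[c ->] [y y2 ->]] := subvP genA _ (memvf u).
rewrite linearDr linearZr_LR /= symC Hav mulr0 add0r.
have : (lsa_pow mul 2 <= orthov H <[v]>)%VS.
  apply/lsa_prodvP => x z _ _; rewrite mem_orthov1 (hessian_mul abA hessH).
  by rewrite mulv linear0r.
by move/subvP/(_ _ y2); rewrite mem_orthov1 symC => /eqP.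
Qed.

Lemma filiform_cayley : filiform mul -> is_cayley (associated_poly mul H).
Proof.
move=> filA; have [a genA] := filiform_gen n_gt0 filA.
have g_neq0 := filiform_pairing_neq0 filA genA.
set g := H a _ in g_neq0.
have an0 : powS mul a n = 0.
  by apply/eqP; rewrite -memv0 -filA.2 memv_powS.
pose l : {scalar {poly R}} := H a \o evX mul a.
have lE p : l p = H a (evX mul a p) by [].
(* H(b, b^n) will be c^(n+1) g, so this c reduces it to the sign of g. *)
have [c c0 cg] : exists2 c : R, c != 0 & c ^+ n.+1 * `|g| = 1.
  by apply: exists_root_inv; rewrite normr_gt0.
have [||//|q ql qn] := @poly_normalize _ l n.-1 c.
- by move=> r; rewrite lE prednK // evX_eq0 ?linear0r.
- by rewrite lE evXn.
pose b := evX mul a q.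
have bn0 : powS mul b n = 0 by rewrite powS_evX // evX_eq0.
pose s := g < 0.
have Hb i : H b (powS mul b i) = (-1) ^+ s * (i == n.-1)%:R.
  have [ni|lt_in] := leqP n i.
    by rewrite (powS_eq0 bn0 ni) linear0r gtn_eqF ?mulr0 // prednK.
  rewrite (powS_evX abA) (hessian_evX abA hessH) mulrCA -exprS -lE.
  have [->|ne_in] := eqVneq i n.-1; last by rewrite ql ?mulr0 //; lia.
  rewrite qn mulr1.
  rewrite prednK // lE evXn -/g [in LHS](realEsign (num_real g)) -/s.
  by rewrite mulrCA cg mulr1.
have HbE p r : H (evX mul b p) (evX mul b r) = (-1) ^+ s * (p * r)`_n.-1.
  (* Widening by n keeps the index n - 1 in range when p r is short. *)
  rewrite (hessian_evX abA hessH) (@evX_wide _ _ _ _ _ (size (p * r) + n)) ?leq_addr //.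
  rewrite linear_sumr.
  have ln : (n.-1 < size (p * r)%R + n)%N by lia.
  rewrite (bigD1 (Ordinal ln)) //= linearZr_LR /= Hb eqxx mulr1 mulrC big1 ?addr0 //.
  move=> i; rewrite -val_eqE /= => /negPf ne_in.
  by rewrite linearZr_LR /= Hb ne_in !mulr0.
pose e := [tuple powS mul b i | i < n].
have eE (i : 'I_n) : e`_i = powS mul b i.
  by rewrite (nth_map i) ?size_enum_ord // nth_ord_enum.
have basis_e : basis_of {:A} e.
  rewrite basisEfree subvf size_tuple leqnn andbT andbT; apply/freeP => k k0 i.
  have : evX mul b (\sum_(j < n) k j *: 'X^j) = 0.
    by rewrite evX_sum -[RHS]k0; apply: eq_bigr => j _; rewrite eE.
  (* Up to sign, pairing with b^(n-i) extracts the coefficient of b^(i+1). *)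
  move/(congr1 (fun v => H v (evX mul b 'X^(n.-1 - i)))).
  rewrite linear0l HbE => /eqP; rewrite mulf_eq0 signr_eq0 /= coefMXn.
  have := ltn_ord i => lt_in; rewrite ltnNge leq_subr /= subKn; last by lia.
  rewrite coef_sum (bigD1 i) //= big1 => [|j ne_ji].
    by rewrite coefZ coefXn eqxx mulr1 addr0 => /eqP.
  by rewrite coefZ coefXn eq_sym val_eqE (negPf ne_ji) mulr0.
exists e; split=> //; exists s => x.
set p := \sum_(i < n) coord e i x *: 'X^i.
have xE : x = evX mul b p.
  by rewrite evX_sum {1}(coord_basis basis_e (memvf x)); apply: eq_bigr => i _; rewrite eE.
have pow_x k : powS mul x k = evX mul b ('X^k * p ^+ k.+1) by rewrite xE powS_evX.
rewrite (@associated_polyE _ _ _ _ _ n); last by rewrite pow_x evX_eq0.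
rewrite cayley_polyE mulr_sumr; apply: eq_bigr => k _.
by rewrite pow_x {1}xE HbE mulrCA [p * _]mulrCA -exprS.
Qed.

End Forward.

(** * Coordinates as truncated polynomials *)

Section CoordinatePolynomial.
Variables (K : fieldType) (A : vectType K).
Local Notation n := (\dim {:A}).
Variable e : n.-tuple A.
Hypothesis basis_e : basis_of {:A} e.

(** The i-th basis vector, counted from 0, is meant to be the power i + 1 of a generator; as in
    [evX], one factor X is left out. *)
Definition coord_poly (x : A) : {poly K} := \sum_(i < n) coord e i x *: 'X^i.

Lemma coord_poly_is_linear : linear coord_poly.
Proof.
move=> c x y; rewrite /coord_poly scaler_sumr -big_split; apply: eq_bigr => i _ /=.
by rewrite linearP scalerDl scalerA.
Qed.

HB.instance Definition _ := GRing.isSemilinear.Build K A {poly K} _ coord_poly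
  (GRing.semilinear_linear coord_poly_is_linear).

Lemma coef_coord_poly x (i : 'I_n) : (coord_poly x)`_i = coord e i x.
Proof.
rewrite coef_sum (bigD1 i) //= big1 => [|j ne_ji].
  by rewrite coefZ coefXn eqxx mulr1 addr0.
by rewrite coefZ coefXn eq_sym val_eqE (negPf ne_ji) mulr0.
Qed.

Lemma coord_poly_basis (i : 'I_n) : coord_poly e`_i = 'X^i.
Proof.
rewrite /coord_poly (bigD1 i) //= big1 => [|j ne_ji].
  by rewrite coord_free ?(basis_free basis_e) // eqxx scale1r addr0.
by rewrite coord_free ?(basis_free basis_e) // eq_sym (negPf ne_ji) scale0r.
Qed.

Lemma coord_poly_inj x y :
  (forall i, (i < n)%N -> (coord_poly x)`_i = (coord_poly y)`_i) -> x = y.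
Proof.
move=> xy; rewrite (coord_basis basis_e (memvf x)) (coord_basis basis_e (memvf y)).
by apply: eq_bigr => i _; rewrite -!coef_coord_poly xy.
Qed.

Lemma coord_poly_surj (r : {poly K}) :
  exists x, forall i, (i < n)%N -> (coord_poly x)`_i = r`_i.
Proof.
exists (\sum_(i < n) r`_i *: e`_i) => i lt_in.
rewrite linear_sum coef_sum (bigD1 (Ordinal lt_in)) //= big1 => [|j ne_ji].
  by rewrite linearZ coefZ /= (coord_poly_basis (Ordinal lt_in)) coefXn eqxx mulr1 addr0.
rewrite linearZ coefZ /= coord_poly_basis coefXn eq_sym.
by have /negPf : j != i :> nat := ne_ji; move=> ->; rewrite mulr0.
Qed.

(* In these coordinates the algebra is the ideal X K[X] / (X^(n+1)), and the
   basis consists of the powers of its generator. *)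
Lemma coord_poly_filiform (mul : {bilinear A -> A -> A}) :
  abelian_lsa mul -> (0 < n)%N ->
  (forall y z i, (i < n)%N ->
    (coord_poly (mul y z))`_i = ('X * coord_poly y * coord_poly z)`_i) ->
  filiform mul.
Proof.
move=> abA n_gt0 mulP; pose a := e`_(Ordinal n_gt0).
have aE : coord_poly a = 1 by rewrite coord_poly_basis expr0.
apply: (gen_filiform abA (a := a)).
  (* Multiplication by a shifts coefficients up, so x is x_0 a plus a times the element with the
     coefficients of x shifted down. *)
  apply/subvP => x _; have [y yP] := coord_poly_surj (drop_poly 1 (coord_poly x)).
  apply/memv_addP; exists ((coord_poly x)`_0 *: a); first by rewrite memvZ ?memv_line.
  exists (mul a y); first by rewrite memv_lsa_prod ?memvf.
  apply: coord_poly_inj => i lt_in.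
  rewrite linearD linearZ /= aE coefD coefZ coef1 mulP // aE mulr1 coefXM.
  case: i lt_in => [|i] lt_in /=; first by rewrite mulr1 addr0.
  by rewrite mulr0 add0r yP ?coef_drop_poly ?addn1 // ltnW.
(* Each multiplication brings a factor X; at i = n all coordinates vanish. *)
have low i x : x \in lsa_pow mul i.+1 ->
    forall j, (j < i)%N -> (j < n)%N -> (coord_poly x)`_j = 0.
  elim: i x => [|i IH] x // xi j lt_ji lt_jn.
  rewrite lsa_powSS /lsa_prodv -[X in <<X>>%VS]in_tupleE in xi.
  rewrite (coord_span xi) linear_sum coef_sum big1 // => k _.
  rewrite linearZ coefZ /=.
  have /allpairsP[[u v] /= [_ /vbasis_mem vi ->]] := mem_nth 0 (ltn_ord k).
  rewrite mulP // -mulrA coefXM.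
  case: j lt_ji lt_jn => [|j] lt_ji lt_jn; first by rewrite mulr0.
  rewrite coefM big1 ?mulr0 // => m _.
  by rewrite (IH v) ?mulr0 //; have := ltn_ord m; lia.
apply/eqP; rewrite -subv0; apply/subvP => x xn; rewrite memv0; apply/eqP.
by apply: coord_poly_inj => i lt_in; rewrite linear0 coef0 (low n).
Qed.

End CoordinatePolynomial.

(** * From Cayley to filiform *)

Section Backward.
Variables (R : realType) (A : vectType R) (mul : {bilinear A -> A -> A}).
Variable H : {symmetric A}.
Hypothesis n_gt0 : (0 < \dim {:A})%N.
Hypothesis abA : abelian_lsa mul.
Hypothesis compA : complete_lsa mul.
Local Notation n := (\dim {:A}).

Lemma powSZ t x k : powS mul (t *: x) k = t ^+ k.+1 *: powS mul x k.
Proof.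
by elim: k => //= k IH; rewrite IH linearZl_LR linearZr_LR /= scalerA -exprS.
Qed.

(** At t x both expressions of F are polynomials in t; the coefficients of t^(k+2) are compared. *)
Lemma cayley_homogeneous (e : n.-tuple A) s k x :
  (forall x, associated_poly mul H x =
     (-1) ^+ s * cayley_poly (fun i => coord e i x)) ->
  H x (powS mul x k) = (-1) ^+ s * ('X^k * coord_poly e x ^+ k.+2)`_n.-1.
Proof.
move=> FE; have nilA y : powS mul y n = 0 := complete_powS abA y n_gt0 compA.
have [le_nk|lt_kn] := leqP n k.
  rewrite (powS_eq0 (nilA x) le_nk) linear0r coefXnM ifT ?mulr0 //; lia.
pose d j := H x (powS mul x j) - (-1) ^+ s * ('X^j * coord_poly e x ^+ j.+2)`_n.-1.
pose P : {poly R} := \poly_(j < n) ((-1) ^+ j / j.+2%:R * d j).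
have P0 : P = 0.
  apply: poly_roots_eq0 => t t0.
  (* [P] is the difference of the two expressions divided by t^2, whence the restriction to nonzero
     t. *)
  apply: (mulfI (expf_neq0 2 t0)); rewrite mulr0 horner_poly mulr_sumr.
  have := FE (t *: x); rewrite (associated_polyE H (nilA _)) cayley_polyE.
  rewrite -/(coord_poly e (t *: x)) linearZ /= mulr_sumr => /eqP.
  rewrite -subr_eq0 -sumrB => /eqP {2}<-; apply: eq_bigr => j _.
  rewrite powSZ linearZl_LR linearZr_LR /= exprZn -scalerAr coefZ /d !exprS; ring.
have /eqP := congr1 (fun p : {poly R} => p`_k) P0.
rewrite /= coef_poly lt_kn coef0 !mulf_eq0 signr_eq0 invr_eq0 pnatr_eq0 /=.
by rewrite subr_eq0 => /eqP.
Qed.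

Hypothesis hessH : hessian_type mul H.

Lemma cayley_filiform : is_cayley (associated_poly mul H) -> filiform mul.
Proof.
move=> [e [basis_e [s FE]]].
have hom := cayley_homogeneous _ _ FE; pose phi := coord_poly e.
have sum_phi x y : phi (x + y) = phi x + phi y by rewrite /phi linearD.
have HE x y : H x y = (-1) ^+ s * (phi x * phi y)`_n.-1.
  have := hom 0%N (x + y); have := hom 0%N x; have := hom 0%N y.
  rewrite /powS /= !expr0 !mul1r -/phi sum_phi !expr2 => Hy Hx.
  rewrite linearDl !linearDr /= Hx Hy (symC H y x).
  rewrite mulrDl !mulrDr !coefD (mulrC (phi y) (phi x)) !mulrDr.
  by move=> ?; lra.
pose T x y z := H x (mul y z) - (-1) ^+ s * ('X * phi x * phi y * phi z)`_n.-1.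
(* The Hessian condition gives symmetry in the first two arguments, commutativity in the last two;
   the cubic part of F is the diagonal. *)
have T0 : forall x y z, T x y z = 0.
  apply: trilinear_polarization.
  - move=> x x' y z; rewrite /T sum_phi linearDl /= mulrDr !mulrDl coefD; ring.
  - by move=> x y z; rewrite /T hessH -['X * phi x * phi y]mulrA (mulrC (phi x)) mulrA.
  - move=> x y z; rewrite /T (abelian_mulC abA) -['X * phi x * phi y * phi z]mulrA.
    by rewrite (mulrC (phi y)) mulrA.
  - move=> x; rewrite /T (hom 1%N x) -/phi.
    by rewrite !exprS !expr0 !mulr1 !mulrA subrr.
apply: (coord_poly_filiform basis_e abA n_gt0) => y z i lt_in.
have lt_j : (n.-1 - i < n)%N by lia.
(* The basis vector of index n - 1 - i has polynomial X^(n-1-i), so pairing with it reads off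
   coefficient i of the product. *)
have /eqP := T0 e`_(Ordinal lt_j) y z.
rewrite /T HE /phi (coord_poly_basis basis_e) /= -mulrBr mulf_eq0 signr_eq0 /=.
rewrite subr_eq0 -!mulrA (mulrCA 'X) !coefXnM.
by rewrite ltnNge leq_subr /= subKn; [move/eqP | lia].
Qed.

End Backward.

Theorem theorem4p8 (R : realType) (A : vectType R)
    (mul : {bilinear A -> A -> A}) (H : {symmetric A}) :
  (1 <= \dim {:A})%N ->
  abelian_lsa mul ->
  complete_lsa mul ->
  nondegenerate H ->
  hessian_type mul H ->
  filiform mul <-> is_cayley (associated_poly mul H).
Proof.
move=> n_gt0 abA compA ndH hessH; split; first exact: filiform_cayley.
exact: cayley_filiform.
Qed.
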